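(* The Banach lattice $L_1=L_1[0,1]$ admits no $\sigma$-order basis.
   Context: $L_1[0,1]$ is the real Banach lattice of (classes of) Lebesgue integrable functions on $[0,1]$ with the almost everywhere order. A sequence $(x_n)$ in a Banach lattice $X$ $\sigma$-order converges to $x$ if there is a sequence $(z_m)$ in $X$, decreasing with infimum $0$ in $X$, such that for every $m$, $|x_n-x|\le z_m$ for all but finitely many $n$. A sequence $(e_n)_{n=1}^\infty$ is a $\sigma$-order basis for $X$ if for every $x\in X$ there is a unique $(a_n)\in\mathbb R^{\mathbb N}$ such that the partial sums $\sum_{n=1}^m a_ne_n$ $\sigma$-order converge to $x$ as $m\to\infty$. *)

(* Defs.v *)
From HB Require Import structures.
From mathcomp Require Import all_boot all_order all_algebra.
From mathcomp Require Import all_classical all_reals all_analysis.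
From mathcomp Require Import measurable_realfun.

Set Implicit Arguments.
Unset Strict Implicit.
Unset Printing Implicit Defensive.

Import Order.TTheory GRing.Theory Num.Theory.
Import numFieldNormedType.Exports.

Local Open Scope classical_set_scope.
Local Open Scope ring_scope.

(* Vector lattices; binary infima exist automatically, as - sup (- x) (- y). *)
HB.mixin Record POrderedLmodule_isVectorLattice (R : numDomainType) X
    of GRing.Lmodule R X & Order.POrder ring_display X := {
  vlat_leD2r : forall z x y : X, x <= y -> x + z <= y + z ;
  vlat_scale_ge0 : forall (a : R) (x : X), 0 <= a -> 0 <= x -> 0 <= a *: x ;
  vlat_sup : X -> X -> X ;
  vlat_supP : forall x y z : X,
    (vlat_sup x y <= z) = (x <= z) && (y <= z) }.

#[short(type="vectorLatticeType")]
HB.structure Definition VectorLattice (R : numDomainType) :=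
  { X of POrderedLmodule_isVectorLattice R X &
         GRing.Lmodule R X & Order.POrder ring_display X }.

Section SigmaOrder.
Context (R : numDomainType) (X : vectorLatticeType R).

Definition vlat_abs (x : X) : X := vlat_sup x (- x).

Definition sigma_order_cvg (x_ : nat -> X) (x : X) : Prop :=
  exists z : nat -> X,
    [/\ nonincreasing_seq z,
        infimums (range z) 0 &
        forall m, \forall n \near \oo, vlat_abs (x_ n - x) <= z m].

(* [series u] is indexed from 0 and starts with the empty sum, which does not
   affect convergence. *)
Definition sigma_order_basis (e : nat -> X) : Prop :=
  forall x : X, exists! a : nat -> R,
    sigma_order_cvg (series (fun n => a n *: e n)) x.

End SigmaOrder.

Section L1space.
Context d (T : measurableType d) (R : realType).
Variable mu : {measure set T -> \bar R}.

(* The elements of [LspaceType1 mu] are the a.e.-classes of integrable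
   functions; the vector lattice structure below is computed on the
   representatives [L1fun f]. *)
Definition L1space : Type := LspaceType1 mu.

HB.instance Definition _ := gen_eqMixin L1space.
HB.instance Definition _ := gen_choiceMixin L1space.

Implicit Types f g h : L1space.

Definition L1fun f : T -> R := (f : LspaceType1 mu).

Lemma L1fun_Lfun f : L1fun f \in Lfun mu 1.
Proof.
rewrite inE; apply/andP; split; rewrite inE /=.
  exact: (@measurable_funPT _ _ _ _ (repr (LebesgueSpace.sort f))).
exact: Lebesgue_finite.
Qed.

Lemma L1_ext f g : (\forall x \ae mu, L1fun f x = L1fun g x) -> f = g.
Proof.
case: f g => [f [[nf]]] [g [[ng]]] fg.
have e : f = g.
  have /eqP : f == g %[mod {mfun_ mu, T >-> measurableTypeR R}]%qT.
    by apply/ae_eqP; apply: filterS fg => x + _.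
  by rewrite !reprK.
by move: e nf ng fg => -> nf ng _; rewrite (Prop_irrelevance nf ng).
Qed.

Let mabs (w : T -> R) : measurable_fun setT w ->
  measurable_fun setT (fun x => `|(EFin \o w) x|%E).
Proof. by move=> mw; apply: measurableT_comp => //; exact/measurable_EFinP. Qed.

Section Class.
Variables (u : T -> R) (uL : u \in Lfun mu 1).

Let um : u \in (@mfun _ _ T (measurableTypeR R)).
Proof. by move: uL; rewrite inE => /andP[]. Qed.

Let v : {mfun T >-> measurableTypeR R} :=
  @mfun_Sub _ _ T (measurableTypeR R) u um.

Let c : {mfun_ mu, T >-> measurableTypeR R} :=
  (\pi_({mfun_ mu, T >-> measurableTypeR R}) v)%qT.

Let cE : \forall x \ae mu, c x = u x.
Proof.
have : ae_eq_op mu (repr c) v by apply/eqmodP; rewrite reprK.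
by move=> /asboolP; apply: filterS => x; apply.
Qed.

Let c_fin : finite_norm mu 1 c.
Proof.
have : finite_norm mu 1 u by move: uL; rewrite inE => /andP[_]; rewrite inE.
suff e : ('N[mu]_1[EFin \o c] = 'N[mu]_1[EFin \o u])%E by rewrite /finite_norm e.
rewrite !Lnorm1; apply: ae_eq_integral => //.
- apply: (@mabs c).
  exact: (@measurable_funPT _ _ _ _ (repr c)).
- by apply: mabs; move: uL; rewrite inE => /andP[]; rewrite inE.
- by apply: filterS cE => x /= -> _.
Qed.

Definition L1class : L1space :=
  LebesgueSpace.Pack (LebesgueSpace.Class
    (isFinLebesgue.Build _ _ _ mu 1%E (lexx _) c c_fin)).

Lemma L1classE : \forall x \ae mu, L1fun L1class x = u x.
Proof. exact: cE. Qed.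

End Class.

Let Lfun0 : (fun=> 0) \in Lfun mu 1.
Proof. exact: (LfunP (0 : LfunType mu (lexx 1%E))). Qed.

Let LfunD f g : (fun x => L1fun f x + L1fun g x) \in Lfun mu 1.
Proof. by apply: (Lfun_addr_closed mu (lexx 1%E)).2; exact: L1fun_Lfun. Qed.

Let LfunN f : (fun x => - L1fun f x) \in Lfun mu 1.
Proof. by apply: Lfun_oppr_closed; exact: L1fun_Lfun. Qed.

Let LfunZ a f : (fun x => a * L1fun f x) \in Lfun mu 1.
Proof.
have := (Lfun_submod_closed mu (lexx 1%E)).2 a _ _ (L1fun_Lfun f) Lfun0.
by rewrite addr0.
Qed.

Let Lfun_max f g : (fun x => Num.max (L1fun f x) (L1fun g x)) \in Lfun mu 1.
Proof.
have -> : (fun x => Num.max (L1fun f x) (L1fun g x)) =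
    2^-1 *: (((L1fun f : T -> R) + L1fun g) +
             (Num.norm \o ((L1fun f : T -> R) - L1fun g) : T -> R)).
  by apply/funext => x; rewrite maxr_absE mulrC !fctE.
have [l0 lZD] := Lfun_submod_closed mu (lexx 1%E).
have lD (u v : T -> R) : u \in Lfun mu 1 -> v \in Lfun mu 1 ->
    u + v \in Lfun mu 1.
  by move=> uL vL; exact: ((Lfun_addr_closed mu (lexx 1%E)).2 u v uL vL).
have lB : (L1fun f : T -> R) - L1fun g \in Lfun mu 1.
  exact: lD (L1fun_Lfun f) (LfunN g).
have lm := lD _ _ (lD _ _ (L1fun_Lfun f) (L1fun_Lfun g)) (Lfun_norm lB).
by have := lZD 2^-1 _ _ lm l0; rewrite addr0.
Qed.

Definition L1_zero : L1space := L1class Lfun0.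
Definition L1_add f g : L1space := L1class (LfunD f g).
Definition L1_opp f : L1space := L1class (LfunN f).
Definition L1_scale a f : L1space := L1class (LfunZ a f).
Definition L1_sup f g : L1space := L1class (Lfun_max f g).
Definition L1_le f g : bool := `[< \forall x \ae mu, L1fun f x <= L1fun g x >].

Lemma L1_zeroE : \forall x \ae mu,
  L1fun L1_zero x = 0.
Proof. exact: L1classE. Qed.

Lemma L1_addE f g : \forall x \ae mu,
  L1fun (L1_add f g) x = L1fun f x + L1fun g x.
Proof. exact: L1classE. Qed.

Lemma L1_oppE f : \forall x \ae mu,
  L1fun (L1_opp f) x = - L1fun f x.
Proof. exact: L1classE. Qed.

Lemma L1_scaleE a f : \forall x \ae mu,
  L1fun (L1_scale a f) x = a * L1fun f x.
Proof. exact: L1classE. Qed.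

Lemma L1_supE f g : \forall x \ae mu,
  L1fun (L1_sup f g) x = Num.max (L1fun f x) (L1fun g x).
Proof. exact: L1classE. Qed.

Let L1_addA : associative L1_add.
Proof.
move=> f g h; apply: L1_ext; near=> x.
rewrite (near (L1_addE f (L1_add g h)) x)// (near (L1_addE (L1_add f g) h) x)//.
by rewrite (near (L1_addE f g) x)// (near (L1_addE g h) x)// addrA.
Unshelve. all: by end_near. Qed.

Let L1_addC : commutative L1_add.
Proof.
move=> f g; apply: L1_ext; near=> x.
by rewrite (near (L1_addE f g) x)// (near (L1_addE g f) x)// addrC.
Unshelve. all: by end_near. Qed.

Let L1_add0 : left_id L1_zero L1_add.
Proof.
move=> f; apply: L1_ext; near=> x.
by rewrite (near (L1_addE L1_zero f) x)// (near L1_zeroE x)// add0r.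
Unshelve. all: by end_near. Qed.

Let L1_addN : left_inverse L1_zero L1_opp L1_add.
Proof.
move=> f; apply: L1_ext; near=> x.
rewrite (near (L1_addE (L1_opp f) f) x)// (near L1_zeroE x)//.
by rewrite (near (L1_oppE f) x)// addNr.
Unshelve. all: by end_near. Qed.

HB.instance Definition _ :=
  GRing.isZmodule.Build L1space L1_addA L1_addC L1_add0 L1_addN.

Let L1_scaleA a b f : L1_scale a (L1_scale b f) = L1_scale (a * b) f.
Proof.
apply: L1_ext; near=> x.
rewrite (near (L1_scaleE a (L1_scale b f)) x)// (near (L1_scaleE b f) x)//.
by rewrite (near (L1_scaleE (a * b) f) x)// mulrA.
Unshelve. all: by end_near. Qed.

Let L1_scale1 : left_id 1 L1_scale.
Proof.
move=> f; apply: L1_ext; near=> x.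
by rewrite (near (L1_scaleE 1 f) x)// mul1r.
Unshelve. all: by end_near. Qed.

Let L1_scaleDr : right_distributive L1_scale +%R.
Proof.
move=> a f g; apply: L1_ext; near=> x.
rewrite (near (L1_scaleE a (L1_add f g)) x)// (near (L1_addE f g) x)//.
rewrite (near (L1_addE (L1_scale a f) (L1_scale a g)) x)//.
by rewrite (near (L1_scaleE a f) x)// (near (L1_scaleE a g) x)// mulrDr.
Unshelve. all: by end_near. Qed.

Let L1_scaleDl f : {morph L1_scale^~ f : a b / a + b}.
Proof.
move=> a b; apply: L1_ext; near=> x.
rewrite (near (L1_scaleE (a + b) f) x)//.
rewrite (near (L1_addE (L1_scale a f) (L1_scale b f)) x)//.
by rewrite (near (L1_scaleE a f) x)// (near (L1_scaleE b f) x)// mulrDl.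
Unshelve. all: by end_near. Qed.

HB.instance Definition _ :=
  GRing.Zmodule_isLmodule.Build R L1space
    L1_scaleA L1_scale1 L1_scaleDr L1_scaleDl.

Let L1_le_refl : reflexive L1_le.
Proof. by move=> f; apply/asboolP; near=> x. Unshelve. all: by end_near. Qed.

Let L1_le_anti : antisymmetric L1_le.
Proof.
move=> f g /andP[/asboolP fg /asboolP gf]; apply: L1_ext; near=> x.
by apply/eqP; rewrite eq_le (near fg x)// (near gf x).
Unshelve. all: by end_near. Qed.

Let L1_le_trans : transitive L1_le.
Proof.
move=> g f h /asboolP fg /asboolP gh; apply/asboolP; near=> x.
by apply: le_trans (near gh x _) => //; exact: (near fg x).
Unshelve. all: by end_near. Qed.

HB.instance Definition _ :=
  Order.Le_isPOrder.Build ring_display L1space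
    L1_le_refl L1_le_anti L1_le_trans.

Let L1_leD2r h f g : f <= g -> f + h <= g + h.
Proof.
move=> /asboolP fg; apply/asboolP; near=> x.
rewrite (near (L1_addE f h) x)// (near (L1_addE g h) x)//.
by rewrite lerD2r; exact: (near fg x).
Unshelve. all: by end_near. Qed.

Let L1_scale_ge0 a f : 0 <= a -> 0 <= f -> 0 <= a *: f.
Proof.
move=> a0 /asboolP f0; apply/asboolP; near=> x.
rewrite (near L1_zeroE x)// (near (L1_scaleE a f) x)// mulr_ge0//.
by rewrite -(near L1_zeroE x)//; exact: (near f0 x).
Unshelve. all: by end_near. Qed.

Let L1_supP f g h : (L1_sup f g <= h) = (f <= h) && (g <= h).
Proof.
apply/idP/andP => [/asboolP s|[/asboolP fh /asboolP gh]].
  suff: \forall x \ae mu, L1fun f x <= L1fun h x /\ L1fun g x <= L1fun h x.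
    by move=> H; split; apply/asboolP; apply: filterS H => x [].
  near=> x; apply/andP; rewrite -ge_max -(near (L1_supE f g) x)//.
  exact: (near s x).
apply/asboolP; near=> x.
by rewrite (near (L1_supE f g) x)// ge_max (near fh x)// (near gh x).
Unshelve. all: by end_near. Qed.

HB.instance Definition _ :=
  POrderedLmodule_isVectorLattice.Build R L1space
    L1_leD2r L1_scale_ge0 L1_supP.

End L1space.

(* Functions are defined on all of R, but are identified when they agree a.e. on
   [0, 1]. Representatives are Borel: this loses no class, since every Lebesgue
   measurable function is a.e. equal to a Borel one. *)
Definition L1_01 (R : realType) : vectorLatticeType R :=
  L1space (mrestr (@lebesgue_measure R) (measurable_itv `[0, 1])).

(* Main.v *)
(* If (e_n) were a sigma-order basis, the partial sum operators P_m would satisfy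
   the maximal inequality [int sup_m |P_m x| <= M * ||x||_1]: order convergence
   in L_1 is dominated a.e. convergence, so the left-hand side is a finite,
   countably subadditive seminorm, and Zabreiko's lemma (Baire category)
   applies.  Summing it over the dyadic intervals I of length 2^-k shows that,
   for a.e. s, [sum_I sup_m |P_m 1_I (s)|] is bounded in k.  For such an s,
   I |-> P_m 1_I (s) is additive and bounded by C_m |I|, as if it had a bounded
   density, but tends to the Dirac mass at s.  Under domination this is
   impossible: choose k and a finite family m < m0 for which
   [sum_I max_(m < m0) |P_m 1_I (s)|] is within 1/2 of the supremum,
     refine until
   the interval containing s contributes less than 1/4, then pass to a larger m
   for which it contributes more than 3/4. *)

Require Import Defs.
From mathcomp Require Import all_boot all_order all_algebra.
From mathcomp Require Import all_classical all_reals all_analysis.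
From mathcomp Require Import measurable_realfun.
From mathcomp Require Import lra ring.

Set Implicit Arguments.
Unset Strict Implicit.
Unset Printing Implicit Defensive.

Import Order.TTheory GRing.Theory Num.Theory.
Import numFieldNormedType.Exports.

Local Open Scope classical_set_scope.
Local Open Scope ring_scope.

(** * Countably subadditive seminorms *)

Section Zabreiko.
Context (R : realType) (V : lmodType R).

Definition seminorm (p : V -> R) : Prop :=
  (forall x y, p (x + y) <= p x + p y) /\
  (forall t x, p (t *: x) = `|t| * p x).

Definition series_to (p : V -> R) (u : nat -> V) (x : V) : Prop :=
  (fun n => p (x - series u n)) @ \oo --> (0 : R).

Lemma seminorm0 p : seminorm p -> p 0 = 0.
Proof. by case=> _ pZ; rewrite -(scale0r 0) pZ normr0 mul0r. Qed.

Lemma seminormN p x : seminorm p -> p (- x) = p x.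
Proof. by case=> _ pZ; rewrite -scaleN1r pZ normrN1 mul1r. Qed.

Lemma seminorm_distC p x y : seminorm p -> p (x - y) = p (y - x).
Proof. by move=> ps; rewrite -(seminormN _ ps) opprB. Qed.

Lemma seminorm_ge0 p x : seminorm p -> 0 <= p x.
Proof.
move=> ps; have := ps.1 x (- x).
by rewrite subrr (seminorm0 ps) (seminormN _ ps); lra.
Qed.

Context (p q : V -> R).
Context (p_seminorm : seminorm p).
Context (q_seminorm : seminorm q).
(** Completeness for [p] in series form: absolute summability, expressed by bounded partial sums,
    yields a [p]-limit. *)
Context (p_complete : forall (u : nat -> V) (C : R),
  (forall n, series (p \o u) n <= C) -> exists x, series_to p u x).
Context (q_csubadd : forall (u : nat -> V) (x : V) (C : R),
  series_to p u x -> (forall n, series (q \o u) n <= C) -> q x <= C).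

Let pB_le x y z : p (x - z) <= p (x - y) + p (y - z).
Proof.
by have := p_seminorm.1 (x - y) (y - z); rewrite addrA subrK.
Qed.

(* Baire's argument: otherwise, nested balls shrink to a point at which [q] is
   infinite. *)
Let ball_approx : exists (x0 : V) (r K : R), 0 < r /\
  forall y, p (y - x0) < r -> forall e, 0 < e ->
  exists2 z, p (y - z) < e & q z <= K.
Proof.
apply: contrapT => /forallNP nball.
have step (b : V * R) (K : R) : exists b' : V * R, 0 < b.2 ->
    [/\ 0 < b'.2, b'.2 <= b.2 / 2, p (b'.1 - b.1) <= b.2 / 2 &
        forall z, p (z - b'.1) <= b'.2 -> K < q z].
  have [b0|] := ltP 0 b.2; last by exists b.
  have b20 : 0 < b.2 / 2 by lra.
  have /forallNP/(_ (b.2/2))/forallNP/(_ K)/not_andP[//|] := nball b.1.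
  move=> /existsNP[y] /not_implyP[yb] /existsNP[e] /not_implyP[e0] /forall2NP
    ye.
  (* The radius is at most [b.2 / 2], so that the balls nest and shrink, and at most [e / 2], so
     that the closed ball stays inside the [e]-ball around [y], where [q] exceeds [K]. *)
  exists (y, Num.min (b.2 / 2) (e / 2)) => _ /=; split.
  - by rewrite lt_min b20; lra.
  - by rewrite ge_min lexx.
  - exact: ltW.
  - move=> z zy; have [|/negP] := ye z; last by rewrite -ltNge.
    by case; rewrite seminorm_distC//; move: zy; rewrite le_min => /andP[_];
      lra.
have [f fP] := choice (fun bK : (V * R) * R => step bK.1 bK.2).
(* At stage [n] the threshold is [n]. The first centre is 0, so the centres are exactly the partial
   sums of their increments. *)
pose b := fix b n : V * R := if n is n'.+1 then f (b n', n'%:R) else (0, 1).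
have b0 n : 0 < (b n).2.
  by elim: n => [|n IH] /=; [exact: ltr01 | have [] := fP (b n, n%:R) IH].
have bS n : [/\ (b n.+1).2 <= (b n).2 / 2,
  p ((b n.+1).1 - (b n).1) <= (b n).2 / 2 &
        forall z, p (z - (b n.+1).1) <= (b n.+1).2 -> n%:R < q z].
  by have [] := fP (b n, n%:R) (b0 n).
(* Centres move by at most the loss of radius, so every later centre, and then the limit, stays in
   the [j]-th closed ball. *)
have bD j n : p ((b (j + n)%N).1 - (b j).1) <= (b j).2 - (b (j + n)%N).2.
  elim: n => [|n IH]; first by rewrite addn0 !subrr seminorm0.
  have := pB_le (b (j + n.+1)%N).1 (b (j + n)%N).1 (b j).1.
  by rewrite addnS; have [] := bS (j + n)%N; lra.
pose u n := (b n.+1).1 - (b n).1.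
have uE n : series u n = (b n).1.
  by rewrite seriesEnat /= telescope_sumr// subr0.
have [n|x xu] := p_complete (u := u) (C := 1).
  suff : series (p \o u) n <= 1 - (b n).2 by have := b0 n; lra.
  elim: n => [|n IH]; first by rewrite /series/= big_geq// subrr.
  rewrite seriesSr /=; have [] := bS n; rewrite -/(u n); lra.
have xb j : p (x - (b j).1) <= (b j).2.
  apply/ler_addgt0Pr => e e0.
  have /(cvgr_lt 0)/(_ e e0)[n _ /(_ (j + n)%N)] := xu;
    rewrite /= leq_addl uE => /(_ isT) xn.
  have := pB_le x (b (j + n)%N).1 (b j).1; have := bD j n;
    have := b0 (j + n)%N; lra.
have [_ _ /(_ x (xb _))] := bS (Num.truncn (q x)).+1.
by apply/negP; rewrite -leNgt; apply/ltW/(lt_le_trans (truncnS_gt _)).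
Qed.

(** Translation to the origin: approximate [t^-1 *: y + x0] and [x0] inside the ball and scale the
    difference by [t]; the contribution of [x0] cancels. *)
Let zero_approx : exists r K : R, [/\ 0 < r, 0 < K &
  forall t y e, 0 < t -> p y < r * t -> 0 < e ->
  exists2 z, p (y - z) < e & q z <= K * t].
Proof.
have [x0 [r [K [r0 xrK]]]] := ball_approx.
exists r, (2 * `|K| + 1); split=> [//||t y e t0 yr e0];
  first by have := normr_ge0 K; lra.
have et : 0 < e / t / 2 by rewrite !divr_gt0.
have [z1 z1y z1q] : exists2 z, p ((t^-1 *: y + x0) - z) < e / t / 2 & q z <= K.
  apply: xrK => //; rewrite addrK p_seminorm.2 gtr0_norm ?invr_gt0//.
  by rewrite mulrC ltr_pdivrMr.
have [z0 z0y z0q] : exists2 z, p (x0 - z) < e / t / 2 & q z <= K.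
  by apply: xrK => //; rewrite subrr (seminorm0 p_seminorm).
exists (t *: (z1 - z0)).
  have -> : y - t *: (z1 - z0) = t *: ((t^-1 *: y + x0 - z1) - (x0 - z0)).
    rewrite (opprB x0) (addrAC _ x0) addrA (addrAC _ x0) addrK -addrA.
    rewrite (addrC (- z1)) -(opprB z1) [in RHS]scalerBr.
    by rewrite (scalerA t) mulfV ?gt_eqF// scale1r.
  rewrite p_seminorm.2 gtr0_norm// mulrC -ltr_pdivlMr//.
  apply: le_lt_trans (p_seminorm.1 _ _) _; rewrite seminormN//; lra.
rewrite q_seminorm.2 gtr0_norm// mulrC ler_wpM2r ?(ltW t0)//.
apply: le_trans (q_seminorm.1 _ _) _; rewrite seminormN//.
have := ler_norm K; lra.
Qed.

(** Successive approximation as in the open mapping theorem: the bound on the remainder is halved at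
    each step, the approximants satisfy [q z <= K * (t / 2 ^+ n)], and countable subadditivity sums
    these bounds to [2 * (K * t)]. *)
Lemma zabreiko : exists2 M, 0 <= M & forall x, q x <= M * p x.
Proof.
have [r [K [r0 K0 rK]]] := zero_approx.
have bnd x t : 0 < t -> p x < r * t -> q x <= 2 * (K * t).
  move=> t0 xt.
  have h0 n : 0 < t / 2 ^+ n by rewrite divr_gt0// exprn_gt0.
  have step (yn : V * nat) : exists z, p yn.1 < r * (t / 2 ^+ yn.2) ->
      p (yn.1 - z) < r * (t / 2 ^+ yn.2.+1) /\ q z <= K * (t / 2 ^+ yn.2).
    have [yr|yr] := ltP (p yn.1) (r * (t / 2 ^+ yn.2)); last first.
      by exists 0 => ?; lra.
    have [] := rK _ _ (r * (t / 2 ^+ yn.2.+1)) (h0 _) yr;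
      first by rewrite mulr_gt0.
    by move=> z ? ?; exists z.
  have [f fP] := choice step.
  (* [y n] is the remainder after [n] approximants; the bound on it is what lets the next one be
     chosen. *)
  pose y := fix y n := if n is n'.+1 then y n' - f (y n', n') else x.
  have yr n : p (y n) < r * (t / 2 ^+ n).
    elim: n => [|n IH] /=; first by rewrite expr0 divr1.
    by have [] := fP (y n, n) IH.
  pose z n := f (y n, n).
  have zE n : x - series z n = y n.
    elim: n => [|n IH]; first by rewrite /series/= big_geq// subr0.
    by rewrite seriesSr opprD addrA IH.
  apply: (q_csubadd (u := z)) => [|n].
    rewrite /series_to; under eq_fun do rewrite zE.
    have gcvg : (fun n => r * t * (1/2) ^+ n) @ \oo --> (0 : R).
      rewrite -[X in _ --> X](mulr0 (r * t)); apply: cvgMr.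
      by apply: cvg_expr; rewrite ger0_norm; lra.
    apply: (squeeze_cvgr _ (cvg_cst 0) gcvg); near=> n; apply/andP; split.
      exact: seminorm_ge0.
    by rewrite expr_div_n expr1n div1r -mulrA; exact/ltW/yr.
  suff : series (q \o z) n <= 2 * (K * t) - 2 * (K * (t / 2 ^+ n)).
    have := mulr_gt0 K0 (h0 n); lra.
  elim: n => [|n IH]; first by rewrite /series/= big_geq// expr0 divr1 subrr.
  rewrite seriesSr /=; have [_] := fP (y n, n) (yr n); rewrite -/(z n) /=.
  have -> : t / 2 ^+ n.+1 = t / 2 ^+ n / 2 by rewrite exprSr invfM mulrA.
  by move: (t / 2 ^+ n) (series _ _) IH => a s; lra.
exists (2 * K / r) => [|x]; first by rewrite divr_ge0//; lra.
apply/ler_addgt0Pr => e e0.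
have px0 := seminorm_ge0 x p_seminorm.
(* The slack [d] makes [p x < r * t] strict and [t] positive, also when [p x = 0]; it contributes
   exactly [e] to the final bound. *)
pose d := e * r / (2 * K).
have d0 : 0 < d by rewrite divr_gt0 ?mulr_gt0.
apply: le_trans (bnd x ((p x + d) / r) _ _) _.
- by rewrite divr_gt0//; lra.
- by rewrite mulrCA divff ?gt_eqF// mulr1; lra.
- rewrite le_eqVlt; apply/orP; left; apply/eqP; rewrite /d; field.
  by rewrite !gt_eqF.
Unshelve. all: by end_near. Qed.

End Zabreiko.

(** * Real series and dyadic refinements *)

Section RealSeries.
Context (R : realType).
Implicit Types (a g : R ^nat).

Lemma is_cvg_series_le_bound g C :
  (forall k, 0 <= g k) -> (forall n, series g n <= C) -> cvgn (series g).
Proof.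
move=> g0 gC; apply: nondecreasing_is_cvgn.
  by apply/nondecreasing_seqP => n; rewrite seriesSr lerDl.
by exists C => _ [n _ <-].
Qed.

Lemma series_tail_le a g s l n : (forall k, `|a k| <= g k) ->
  series a @ \oo --> s -> series g @ \oo --> l ->
  `|s - series a n| <= l - series g n.
Proof.
move=> ag as_ gl.
have al : (fun m => `|series a m - series a n|) @ \oo --> `|s - series a n|.
  by apply: cvg_norm; apply: cvgB => //; exact: cvg_cst.
have gl' : (fun m => series g m - series g n) @ \oo --> l - series g n.
  by apply: cvgB => //; exact: cvg_cst.
apply: (ler_cvg_to al gl'); near=> m.
have nm : (n <= m)%N by near: m; exact: nbhs_infty_ge.
rewrite !sub_series_geq//.
by apply: le_trans (ler_norm_sum _ _ _) _; apply: ler_sum.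
Unshelve. all: by end_near. Qed.

Lemma series_norm_le a g s C : (forall k, `|a k| <= g k) ->
  (forall n, series g n <= C) -> series a @ \oo --> s -> `|s| <= C.
Proof.
move=> ag gC as_.
have al : (fun n => `|series a n|) @ \oo --> `|s| by exact: cvg_norm.
apply: (cvgr_to_le al); near=> m; apply: le_trans (gC m).
by apply: le_trans (ler_norm_sum _ _ _) _; apply: ler_sum.
Unshelve. all: by end_near. Qed.

(** Dominated convergence for series: the first [K] terms converge one by one, while the tails of
    all the series are at most the tail of the series of [g]. *)
Lemma tannery (u : nat -> R ^nat) g C (v w : R ^nat) (z : R) :
  (forall k m, `|u k m| <= g k) -> (forall n, series g n <= C) ->
  (forall k, u k @ \oo --> v k) ->
  (forall m, series (u ^~ m) @ \oo --> w m) ->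
  series v @ \oo --> z -> w @ \oo --> z.
Proof.
move=> ug gC uv uw vz.
have g0 k : 0 <= g k by exact: le_trans (ug k 0).
have vg k : `|v k| <= g k.
  have vl : (fun m => `|u k m|) @ \oo --> `|v k| by exact: cvg_norm.
  by apply: (cvgr_to_le vl); near=> m; exact: ug.
have gl := is_cvg_series_le_bound g0 gC.
set l := limn (series g) in gl.
have uvK K : (fun m => series (u ^~ m) K) @ \oo --> series v K.
  elim: K => [|K IH].
    by rewrite /series/= big_geq//; under eq_fun do rewrite big_geq//;
      exact: cvg_cst.
  under eq_fun do rewrite seriesSr.
  by rewrite seriesSr; exact: cvgD.
apply/cvgrPdist_lt => e e0.
have e3 : 0 < e / 3 by rewrite divr_gt0.
have [K _ /(_ K (leqnn _)) /= Kl] := (cvgrPdist_lt _ _).1 gl _ e3.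
have {}Kl : l - series g K < e / 3 by exact: le_lt_trans (ler_norm _) Kl.
near=> m.
have h1 := series_tail_le K (ug^~ m) (uw m) gl.
have h2 := series_tail_le K vg vz gl.
have h3 : `|series v K - series (u^~ m) K| < e / 3.
  by near: m; exact: (cvgrPdist_lt _ _).1 (uvK K) _ e3.
have -> : z - w m = (z - series v K) + (series v K - series (u^~ m) K) -
  (w m - series (u^~ m) K) by lra.
apply: le_lt_trans (ler_normB _ _) _;
  have := ler_normD (z - series v K) (series v K - series (u^~ m) K); lra.
Unshelve. all: by end_near. Qed.

End RealSeries.

(** * Dyadic sums and the Dirac mass *)

Section Dyadic.
Context (R : realType).

(** Matches the intervals of one dyadic level with their parents, since interval [i] splits into
    [i.*2] and [i.*2.+1]. *)
Lemma big_nat_double (V : Type) (idx : V) (op : Monoid.law idx)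
    (f : nat -> V) n :
  \big[op/idx]_(0 <= i < n.*2) f i =
  \big[op/idx]_(0 <= i < n) op (f i.*2) (f i.*2.+1).
Proof.
elim: n => [|n IH]; first by rewrite !big_geq.
by rewrite doubleS !big_nat_recr//= IH Monoid.mulmA.
Qed.

(** Here [nu m k i] stands for [P_m 1_I (s)], with [I] the [i]-th interval of level [k]. Raising one
    summand from below 1/4 to above 3/4 while no other decreases overshoots a supremum that was less
    than 1/2 away. *)
Lemma dyadic_dirac_not_approx (nu : nat -> nat -> nat -> R) (C : nat -> R)
    (B : R) :
  (forall m k i, nu m k i = nu m k.+1 i.*2 + nu m k.+1 i.*2.+1) ->
  (forall m k i, `|nu m k i| <= C m / 2 ^+ k) ->
  (forall m k,
    \sum_(0 <= i < 2 ^ k) \big[Num.max/0]_(j < m) `|nu j k i| <= B) ->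
  (forall k, exists2 i, (i < 2 ^ k)%N &
    (fun m => nu m k i) @ \oo --> (1 : R)) ->
  False.
Proof.
move=> nuD nuC nuB nu1.
pose G m k i := \big[Num.max/0]_(j < m) `|nu j k i|.
pose S m k := \sum_(0 <= i < 2 ^ k) G m k i.
have G0 m k i : 0 <= G m k i by exact: bigmax_ge_id.
have nuG m k i j : (j < m)%N -> `|nu j k i| <= G m k i.
  by move=> jm; have := le_bigmax 0 (fun j : 'I_m => `|nu j k i|) (Ordinal jm).
have Gle m k i c : 0 <= c ->
    (forall j, (j < m)%N -> `|nu j k i| <= c) -> G m k i <= c.
  by move=> c0 nuc; apply/bigmax_leP; split => // j _; exact: nuc.
have Gm m m' k i : (m <= m')%N -> G m k i <= G m' k i.
  by move=> mm'; apply: Gle => // j jm; apply: nuG; exact: leq_trans mm'.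
(* By additivity the maximum of a parent is at most the sum of the maxima of its children, so
   refinement never decreases the sum. *)
have Sk m k k' : (k <= k')%N -> S m k <= S m k'.
  move=> /subnK <-; elim: (k' - k)%N => [//|{}k' IH].
  apply: le_trans IH _; rewrite addSn /S expnS mul2n big_nat_double.
  apply: ler_sum => i _; apply: Gle => [|j jm]; first exact: addr_ge0.
  by rewrite nuD; apply: le_trans (ler_normD _ _) _; apply: lerD; exact: nuG.
pose A := [set S mk.1 mk.2 | mk in [set: nat * nat]].
have supA : has_sup A.
  split; first by exists (S 0 0), (0, 0).
  by exists B => _ [[m k] _ <-]; exact: nuB.
have SA m k : S m k <= sup A by apply: (ub_le_sup supA.2); exists (m, k).
have [_ [[m k0] _ <-] /= Smk0] := @sup_adherent R A (1 / 2) ltac:(lra) supA.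
pose C' := \big[Num.max/0]_(j < m) C j.
have C'0 : 0 <= C' by exact: bigmax_ge_id.
(* [k0 <= k] preserves the near-optimal sum, and [4 * C' < 2 ^+ k] makes each of the finitely many
   densities [C j], [j < m], contribute less than 1/4 on an interval. *)
pose k := maxn k0 (Num.truncn (4 * C')).+1.
have Ck : C' / 2 ^+ k < 1 / 4.
  rewrite ltr_pdivrMr ?exprn_gt0//.
  have : 4 * C' < 2 ^+ k.
    apply: lt_le_trans (truncnS_gt _) _.
    rewrite -natrX ler_nat (leq_trans (leq_maxr k0 _))//; exact/ltnW/ltn_expl.
  lra.
have [i ik nui] := nu1 k.
have Gi : G m k i < 1 / 4.
  apply: le_lt_trans Ck; apply: Gle => [|j jm];
    first by rewrite divr_ge0// exprn_ge0.
  apply: le_trans (nuC _ _ _) _; rewrite ler_wpM2r ?invr_ge0 ?exprn_ge0//.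
  by have := le_bigmax 0 (fun j : 'I_m => C j) (Ordinal jm).
have [m1 _ m1nu] := (cvgrPdist_lt _ _).1 nui (1 / 4) ltac:(lra).
(* [m <= m'] keeps the other summands from decreasing; [m1 <= m'] brings [nu m' k i] within 1/4 of
   1. The index [m'] itself first enters [G m'.+1]. *)
pose m' := maxn m m1.
have nu34 : 3 / 4 < nu m' k i.
  have := m1nu m' (leq_maxr _ _) => /= /(le_lt_trans (ler_norm _)).
  lra.
have Gi' : 3 / 4 < G m'.+1 k i.
  by apply: lt_le_trans (nuG _ _ _ m' _) => //; exact: lt_le_trans (ler_norm _).
have := SA m'.+1 k; have := Sk m k0 k (leq_maxl _ _).
rewrite /S !big_mkord (bigD1 (Ordinal ik))//=.
rewrite [in X in _ -> X](bigD1 (Ordinal ik))//=.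
have : \sum_(j < 2 ^ k | j != Ordinal ik) G m k j <=
    \sum_(j < 2 ^ k | j != Ordinal ik) G m'.+1 k j.
  by apply: ler_sum => j _; apply: Gm; apply: leqW; exact: leq_maxl.
move: Smk0; rewrite /S big_mkord; lra.
Qed.

End Dyadic.

(** * Order convergence and completeness in L_1 *)

Section MaximalFunction.
Context d (T : measurableType d) (R : realType).

(** Extended-valued, so that it is defined without any boundedness; [esups] from index 0 ranges over
    all [n] and comes with measurability. *)
Definition maximal (f : nat -> T -> R) (s : T) : \bar R :=
  esups (fun n => `|f n s|%:E) 0%N.

Implicit Types f : nat -> T -> R.

Lemma maximal_ubound f n s : (`|f n s|%:E <= maximal f s)%E.
Proof. by apply: ereal_sup_ubound; exists n. Qed.

Lemma maximal_le f s c :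
  (forall n, (`|f n s|%:E <= c)%E) -> (maximal f s <= c)%E.
Proof. by move=> fc; apply: ge_ereal_sup => _ [n _ <-]. Qed.

Lemma maximal_ge0 f s : (0 <= maximal f s)%E.
Proof. by apply: le_trans (maximal_ubound f 0 s); rewrite lee_fin. Qed.

Lemma measurable_maximal f : (forall n, measurable_fun setT (f n)) ->
  measurable_fun setT (maximal f).
Proof.
move=> mf; apply: measurable_fun_esups => n; apply/measurable_EFinP.
exact: measurableT_comp.
Qed.

End MaximalFunction.

Section L1Theory.
Context d (T : measurableType d) (R : realType).
Context (mu : {measure set T -> \bar R}).
Local Notation L1 := (L1space mu).
Implicit Types (x y : L1).

Lemma measurable_L1fun x : measurable_fun setT (L1fun x).
Proof. by have := L1fun_Lfun x; rewrite inE => /andP[]; rewrite inE. Qed.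

Lemma integrable_L1fun x : mu.-integrable setT (EFin \o L1fun x).
Proof. by apply/Lfun1_integrable; exact: L1fun_Lfun. Qed.

Lemma L1fun_norm_lty x : (\int[mu]_s `|L1fun x s|%:E < +oo)%E.
Proof. by have /integrableP[_] := integrable_L1fun x. Qed.

Lemma ae_le_Lfun1 (f : T -> R) (g : T -> \bar R) :
  measurable_fun setT f -> measurable_fun setT g -> (forall s, 0 <= g s)%E ->
  (\forall s \ae mu, (`|f s|%:E <= g s)%E) -> (\int[mu]_s g s < +oo)%E ->
  f \in Lfun mu 1.
Proof.
move=> mf mg g0 fg gy; apply/Lfun1_integrable/integrableP; split.
  exact/measurable_EFinP.
apply: le_lt_trans gy; apply: ae_ge0_le_integral => //.
- by apply: measurableT_comp => //; exact/measurable_EFinP.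
- by apply: filterS fg => s sg _.
Qed.

Lemma L1_leP x y : reflect (\forall s \ae mu, L1fun x s <= L1fun y s) (x <= y).
Proof. exact: asboolP. Qed.

Lemma L1_subE x y : \forall s \ae mu, L1fun (x - y) s = L1fun x s - L1fun y s.
Proof.
by apply: filterS2 (L1_addE x (- y)) (L1_oppE y) => s -> ->.
Qed.

Lemma L1_absE x : \forall s \ae mu, L1fun (vlat_abs x) s = `|L1fun x s|.
Proof.
by apply: filterS2 (L1_supE x (- x)) (L1_oppE x) => s -> ->; rewrite maxrN.
Qed.

Lemma L1_seriesE (u : nat -> L1) : \forall s \ae mu, forall n,
  L1fun (series u n) s = series (fun k => L1fun (u k) s) n.
Proof.
apply/ae_foralln; elim=> [|n IH].
  by apply: filterS (L1_zeroE mu) => s; rewrite /series /= !big_geq.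
apply: filterS2 (L1_addE (series u n) (u n)) IH => s + us.
by rewrite !seriesSr us.
Qed.

Lemma L1_ge0P x : (0 <= x) <-> (\forall s \ae mu, 0 <= L1fun x s).
Proof.
split=> [/L1_leP x0|x0].
  by apply: filterS2 (L1_zeroE mu) x0 => s ->.
by apply/L1_leP; apply: filterS2 (L1_zeroE mu) x0 => s ->.
Qed.

(** All but finitely many [x_ n] lie within [z 0] of [x], which gives an integrable dominator. For
    a.e. convergence, the pointwise infimum of the [z m] is itself in L_1 and a lower bound, hence
    a.e. 0. *)
Lemma L1_cvg_dominated (x_ : nat -> L1) x : sigma_order_cvg x_ x ->
  (\forall s \ae mu, (fun n => L1fun (x_ n) s) @ \oo --> L1fun x s) /\
  (\int[mu]_s maximal (fun n => L1fun (x_ n)) s < +oo)%E.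
Proof.
move=> [z [z_ni [z_lb z_glb] xz]].
have z_ge0 m : 0 <= z m by apply: z_lb; exists m.
have [N_ N_xz] : exists N_ : nat -> nat, forall m n, (N_ m <= n)%N ->
    vlat_abs (x_ n - x) <= z m.
  suff /choice[N_ ?] : forall m, exists N, forall n, (N <= n)%N ->
      vlat_abs (x_ n - x) <= z m by exists N_.
  by move=> m; have [N _ Nxz] := xz m; exists N.
have ae_xz : \forall s \ae mu, forall m n, (N_ m <= n)%N ->
    `|L1fun (x_ n) s - L1fun x s| <= L1fun (z m) s.
  apply: ae_foralln => m; apply: ae_foralln => n.
  have [Nn|Nn] := leqP (N_ m) n; last by apply: aeW.
  have /L1_leP := N_xz _ _ Nn;
    apply: filterS3 (L1_absE (x_ n - x)) (L1_subE (x_ n) x).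
  by move=> s -> ->.
have ae_z0 : \forall s \ae mu, forall m, 0 <= L1fun (z m) s.
  by apply: ae_foralln => m; apply/L1_ge0P.
split; last first.
  (* From [N_ 0] on, [|x_n| <= |x| + z 0]; the finite sum covers the earlier terms. *)
  pose h : L1 := vlat_abs x + z 0 + series (fun n => vlat_abs (x_ n)) (N_ 0).
  apply: le_lt_trans (L1fun_norm_lty h); apply: ae_ge0_le_integral => //.
  - by move=> s _; exact: maximal_ge0.
  - by apply: measurable_maximal => n; exact: measurable_L1fun.
  - apply/measurable_EFinP; apply: measurableT_comp => //.
    exact: measurable_L1fun.
  have ae_abs : \forall s \ae mu, forall n,
    L1fun (vlat_abs (x_ n)) s = `|L1fun (x_ n) s|.
    by apply: ae_foralln => n; exact: L1_absE.
  have ae_h : \forall s \ae mu, L1fun h s = `|L1fun x s| + L1fun (z 0) s +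
      series (fun n => `|L1fun (x_ n) s|) (N_ 0).
    near=> s; rewrite (near (L1_addE (vlat_abs x + z 0)
      (series (fun n => vlat_abs (x_ n)) (N_ 0))) s)//.
    rewrite (near (L1_addE (vlat_abs x) (z 0)) s)// (near (L1_absE x) s)//.
    rewrite (near (L1_seriesE (fun n => vlat_abs (x_ n))) s)//; congr (_ + _).
    by apply: eq_bigr => k _; rewrite (near ae_abs s).
  near=> s => _; apply: maximal_le => n.
  rewrite lee_fin (near ae_h s)//.
  have z0s : 0 <= L1fun (z 0) s by apply: (near ae_z0 s).
  have ser0 : 0 <= series (fun n => `|L1fun (x_ n) s|) (N_ 0)
    by exact: sumr_ge0.
  apply: le_trans (ler_norm _).
  have [Nn|nN] := leqP (N_ 0) n.
    have : `|L1fun (x_ n) s - L1fun x s| <= L1fun (z 0) s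
      by apply: (near ae_xz s).
    have := ler_normD (L1fun (x_ n) s - L1fun x s) (L1fun x s); rewrite subrK;
      lra.
  apply: ler_wpDl; first exact: addr_ge0.
  by rewrite /series /= big_mkord (bigD1 (Ordinal nN))//= lerDl sumr_ge0.
(* Pointwise infimum of the [z m]; [fine] loses nothing a.e., where all [z m] are nonnegative and
   the infimum is finite. *)
pose w s := fine (einfs (fun m => (L1fun (z m) s)%:E) 0%N).
have w_le s m : (forall m, 0 <= L1fun (z m) s) -> 0 <= w s <= L1fun (z m) s.
  move=> zs0.
  have ge0 : (0 <= einfs (fun m => (L1fun (z m) s)%:E) 0%N)%E.
    by apply/ereal_infP => _ [k _ <-]; rewrite lee_fin.
  have lez : (einfs (fun m => (L1fun (z m) s)%:E) 0%N <= (L1fun (z m) s)%:E)%E.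
    by apply: ereal_inf_lbound; exists m.
  rewrite /w fine_ge0//= -lee_fin fineK// fin_numElt (lt_le_trans _ ge0)//.
  exact: le_lt_trans lez (ltry _).
have mw : measurable_fun setT w.
  apply: measurableT_comp; first exact: fine_measurable.
  by apply: measurable_fun_einfs => m; apply/measurable_EFinP;
    exact: measurable_L1fun.
have wL : w \in Lfun mu 1.
  apply: (ae_le_Lfun1 (g := fun s => `|L1fun (z 0) s|%:E))
    (L1fun_norm_lty _) => //.
    apply/measurable_EFinP; apply: measurableT_comp => //.
    exact: measurable_L1fun.
  apply: filterS ae_z0 => s zs0; rewrite lee_fin.
  by have /andP[w0 wz] := w_le s 0 zs0; rewrite !ger0_norm.
have /L1_leP w0 : L1class wL <= 0.
  apply: z_glb => _ [m _ <-]; apply/L1_leP.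
  apply: filterS2 (L1classE wL) ae_z0 => s -> zs0.
  by have /andP[] := w_le s m zs0.
have ae_w0 : \forall s \ae mu, w s = 0.
  near=> s; apply/eqP; rewrite eq_le; apply/andP; split.
    rewrite -(near (L1classE wL) s)// -(near (L1_zeroE mu) s)//.
    exact: (near w0 s).
  by have /andP[] : 0 <= w s <= L1fun (z 0) s by apply: w_le;
    apply: (near ae_z0 s).
near=> s.
have ws : w s = 0 by apply: (near ae_w0 s).
have zs0 : forall m, 0 <= L1fun (z m) s by apply: (near ae_z0 s).
apply/cvgrPdist_lt => e e0.
(* Otherwise [e] would bound every [z m] from below at [s], against [w s = 0]. *)
have [m zme] : exists m, L1fun (z m) s < e.
  apply: contrapT => /forallNP ze.
  suff : e <= w s by rewrite ws leNgt e0.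
  have ei : (e%:E <= einfs (fun m => (L1fun (z m) s)%:E) 0%N)%E.
    by apply/ereal_infP => _ [k _ <-]; rewrite lee_fin leNgt; apply/negP/ze.
  rewrite -lee_fin /w fineK// fin_numElt (lt_le_trans _ ei) ?ltNyr//=.
  by apply: (@le_lt_trans _ _ (L1fun (z 0) s)%:E); [apply: ereal_inf_lbound;
    exists 0%N | exact: ltry].
exists (N_ m) => // n /= Nn; rewrite distrC; apply: le_lt_trans zme.
by apply: (near ae_xz s).
Unshelve. all: by end_near. Qed.

Lemma ae_lty_fin (g : T -> \bar R) : measurable_fun setT g ->
  (forall s, 0 <= g s)%E -> (\int[mu]_s g s < +oo)%E ->
  \forall s \ae mu, g s \is a fin_num.
Proof.
move=> mg g0 gy; have : mu.-integrable setT g.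
  by apply/integrableP; split => //; under eq_integral do rewrite gee0_abs//.
by move=> /integrable_ae => /(_ measurableT); apply: filterS => s /(_ I).
Qed.

(** The decreasing sequence is that of the tail suprema of [|x_k - x|]: they are integrable, being
    dominated by [M + |x|], and tend to 0 a.e. *)
Lemma L1_dominated_cvg (x_ : nat -> L1) x :
  (\forall s \ae mu, (fun n => L1fun (x_ n) s) @ \oo --> L1fun x s) ->
  (\int[mu]_s maximal (fun n => L1fun (x_ n)) s < +oo)%E ->
  sigma_order_cvg x_ x.
Proof.
move=> x_x maxy.
set M := maximal _ in maxy.
have mM : measurable_fun setT M.
  by apply: measurable_maximal => n; exact: measurable_L1fun.
have ae_M := ae_lty_fin mM (maximal_ge0 _) maxy.
pose D k s := `|L1fun (x_ k) s - L1fun x s|.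
pose g n s := esups (fun k => (D k s)%:E) n.
have gD n k s : (n <= k)%N -> ((D k s)%:E <= g n s)%E.
  by move=> nk; apply: ereal_sup_ubound; exists k.
have g_le n s c : (forall k, (n <= k)%N -> D k s <= c) -> (g n s <= c%:E)%E.
  by move=> Dc; apply: ge_ereal_sup => _ [k /= nk <-]; rewrite lee_fin Dc.
have g0 n s : (0 <= g n s)%E.
  by apply: le_trans (gD n n s (leqnn n)); rewrite lee_fin normr_ge0.
have g_bound n s : M s \is a fin_num ->
    (g n s <= (fine (M s) + `|L1fun x s|)%:E)%E.
  move=> Ms; apply: g_le => k _; apply: le_trans (ler_normB _ _) _.
  by rewrite lerD2r -lee_fin fineK// maximal_ubound.
have g_fin n s : M s \is a fin_num -> g n s \is a fin_num.
  move=> Ms; rewrite ge0_fin_numE//;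
    exact: le_lt_trans (g_bound n s Ms) (ltry _).
have mg n : measurable_fun setT (fun s => fine (g n s)).
  apply: measurableT_comp; first exact: fine_measurable.
  apply: measurable_fun_esups => k; apply/measurable_EFinP.
  apply: measurableT_comp => //.
  by apply: measurable_funB; exact: measurable_L1fun.
have gL n : (fun s => fine (g n s)) \in Lfun mu 1.
  apply: (ae_le_Lfun1 (g := fun s => (M s + `|L1fun x s|%:E)%E)) => //.
  - apply: emeasurable_funD => //; apply/measurable_EFinP.
    by apply: measurableT_comp => //; exact: measurable_L1fun.
  - by move=> s; rewrite adde_ge0 ?maximal_ge0.
  - apply: filterS ae_M => s Ms; rewrite ger0_norm ?fine_ge0// fineK ?g_fin//.
    by apply: le_trans (g_bound n s Ms) _; rewrite EFinD fineK.
  - rewrite ge0_integralD//.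
    + by rewrite lte_add_pinfty// L1fun_norm_lty.
    + by move=> s _; exact: maximal_ge0.
    + apply/measurable_EFinP.
      by apply: measurableT_comp => //; exact: measurable_L1fun.
have ae_z : \forall s \ae mu, forall n, L1fun (L1class (gL n)) s = fine (g n s).
  by apply: ae_foralln => n; exact: L1classE.
exists (fun n => L1class (gL n)); split.
- apply/nonincreasing_seqP => n; apply/L1_leP.
  apply: filterS2 ae_M ae_z => s Ms zs; rewrite !zs fine_le ?g_fin//.
  by apply: ge_ereal_sup => _ [k /= nk <-]; apply: gD; exact: ltnW.
- split=> [_ [n _ <-]|h h_lb].
    apply/L1_ge0P; apply: filterS ae_z => s ->; exact: fine_ge0.
  (* A lower bound [h] is a.e. below all tail suprema at once, so at a point of convergence it is
     below every [e > 0]. *)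
  apply/L1_leP; have ae_h : \forall s \ae mu, forall n,
    L1fun h s <= fine (g n s).
    apply: ae_foralln => n.
    have /L1_leP : h <= L1class (gL n) by apply: h_lb; exists n.
    by apply: filterS2 ae_z => s ->.
  near=> s; rewrite (near (L1_zeroE mu) s)//; apply/ler_addgt0Pr => e e0.
  have xs : (fun n => L1fun (x_ n) s) @ \oo --> L1fun x s
    by apply: (near x_x s).
  have [n _ nxs] := (cvgrPdist_le _ _).1 xs e e0.
  have Ms : M s \is a fin_num by apply: (near ae_M s).
  have hs : L1fun h s <= fine (g n s) by apply: (near ae_h s).
  apply: le_trans hs _; rewrite add0r -lee_fin fineK ?g_fin//.
  by apply: g_le => k nk; rewrite /D distrC; exact: nxs.
- move=> m; exists m => // n /= mn; apply/L1_leP.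
  near=> s; rewrite (near (L1_absE (x_ n - x)) s)// (near (L1_subE (x_ n) x)
    s)//.
  have Ms : M s \is a fin_num by apply: (near ae_M s).
  have -> : L1fun (L1class (gL m)) s = fine (g m s) by apply: (near ae_z s).
  by rewrite -lee_fin fineK ?g_fin//; exact: gD.
Unshelve. all: by end_near. Qed.

End L1Theory.

(** * Series of nonnegative functions with summable integrals *)

Section IntegralSeries.
Context d (T : measurableType d) (R : realType).
Context (mu : {measure set T -> \bar R}).
Context (G : nat -> T -> \bar R) (c : nat -> R) (C : R).
Context (mG : forall k, measurable_fun setT (G k)).
Context (G0 : forall k s, (0 <= G k s)%E).
Context (Gc : forall k, (\int[mu]_s G k s = (c k)%:E)%E).
Context (cC : forall n, series c n <= C).

Definition nneseries_fun (s : T) : \bar R := (\sum_(0 <= k <oo) G k s)%E.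

Lemma measurable_nneseries_fun : measurable_fun setT nneseries_fun.
Proof. by apply: ge0_emeasurable_sum => //. Qed.

Lemma nneseries_fun_ge0 s : (0 <= nneseries_fun s)%E.
Proof. exact: nneseries_ge0. Qed.

Lemma integral_nneseries_fun_le : (\int[mu]_s nneseries_fun s <= C%:E)%E.
Proof.
rewrite integral_nneseries//; under eq_eseriesr do rewrite Gc.
have c0 k : 0 <= c k by rewrite -lee_fin -Gc; exact: integral_ge0.
apply: lime_le; first by apply: is_cvg_nneseries => k _ _; rewrite lee_fin.
by apply: nearW => n; rewrite sumEFin lee_fin; exact: cC.
Qed.

(** A finite integral forces a finite sum a.e.; the last clause restates this for real partial sums,
    the form in which it serves as a summable dominator at a fixed point. *)
Lemma ae_nneseries_fun_fin : \forall s \ae mu,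
  [/\ nneseries_fun s \is a fin_num, forall k, G k s \is a fin_num &
      forall n, series (fun k => fine (G k s)) n <= fine (nneseries_fun s)].
Proof.
have := ae_lty_fin measurable_nneseries_fun nneseries_fun_ge0
  (le_lt_trans integral_nneseries_fun_le (ltry C)).
apply: filterS => s gs.
have sum_le n : (\sum_(0 <= k < n) G k s <= nneseries_fun s)%E.
  exact: nneseries_lim_ge.
have Gs k : G k s \is a fin_num.
  rewrite ge0_fin_numE//; apply: (@le_lt_trans _ _ (nneseries_fun s)).
    apply: le_trans (sum_le k.+1); rewrite big_nat_recr//= leeDr//.
    exact: sume_ge0.
  by rewrite -ge0_fin_numE// nneseries_fun_ge0.
split => // n; rewrite -lee_fin fineK// /series /= -sumEFin.
by under eq_bigr do rewrite fineK//.
Qed.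

End IntegralSeries.

(** * The L_1 norm and the Riesz-Fischer theorem *)

Section L1Norm.
Context d (T : measurableType d) (R : realType).
Context (mu : {measure set T -> \bar R}).
Local Notation L1 := (L1space mu).
Implicit Types (x y : L1).

Definition L1norm x : R := fine (\int[mu]_s `|L1fun x s|%:E).

Let measurable_L1fun_norm x : measurable_fun setT (fun s => `|L1fun x s|%:E).
Proof.
by apply/measurable_EFinP; apply: measurableT_comp => //;
  exact: measurable_L1fun.
Qed.

Lemma L1normE x : ((L1norm x)%:E = \int[mu]_s `|L1fun x s|%:E)%E.
Proof.
by rewrite fineK// ge0_fin_numE ?L1fun_norm_lty//; apply: integral_ge0 => s _;
  rewrite lee_fin.
Qed.

Lemma L1norm_le x (g : T -> \bar R) c : measurable_fun setT g ->
  (forall s, 0 <= g s)%E -> (\forall s \ae mu, (`|L1fun x s|%:E <= g s)%E) ->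
  (\int[mu]_s g s <= c%:E)%E -> L1norm x <= c.
Proof.
move=> mg g0 xg gc; rewrite -lee_fin L1normE; apply: le_trans gc.
apply: ae_ge0_le_integral => //.
by apply: filterS xg => s + _.
Qed.

Lemma L1norm_seminorm : seminorm (L1norm : L1 -> R).
Proof.
split=> [x y|t x].
  apply: (L1norm_le (g := fun s => (`|L1fun x s|%:E + `|L1fun y s|%:E)%E)).
  - exact: emeasurable_funD.
  - by move=> s; rewrite adde_ge0.
  - by apply: filterS (L1_addE x y) => s ->; rewrite -EFinD lee_fin ler_normD.
  - by rewrite ge0_integralD// EFinD !L1normE.
apply: EFin_inj; rewrite EFinM !L1normE -ge0_integralZl//.
apply: ge0_ae_eq_integral => //.
  exact: measurable_funeM.
by apply: filterS (L1_scaleE t x) => s -> _; rewrite normrM EFinM.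
Qed.

Lemma L1norm_eq0 x : L1norm x = 0 -> x = 0.
Proof.
move=> x0; apply: L1_ext.
have := L1normE x; rewrite x0 => /esym.
under eq_integral do rewrite -abse_EFin.
have mx : measurable_fun setT (EFin \o L1fun x).
  by apply/measurable_EFinP; exact: measurable_L1fun.
move=> /(ae_eq_integral_abs mu measurableT mx).
by apply: filterS2 (L1_zeroE mu) => s -> /(_ I) [].
Qed.

(** Riesz-Fischer: the sum of the [|u k|] has finite integral, so the series converges absolutely
    a.e., and dominated convergence gives convergence in norm. The a.e. limit is retained for the
    exchange of limits in basis expansions. *)
Lemma L1_complete (u : nat -> L1) C : (forall n, series (L1norm \o u) n <= C) ->
  exists x, series_to L1norm u x /\
    \forall s \ae mu, series (fun k => L1fun (u k) s) @ \oo --> L1fun x s.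
Proof.
move=> uC.
pose G k s := (`|L1fun (u k) s|%:E)%E.
have mG k : measurable_fun setT (G k) by exact: measurable_L1fun_norm.
have G0 k s : (0 <= G k s)%E by rewrite lee_fin.
have Gc k : (\int[mu]_s G k s = ((L1norm \o u) k)%:E)%E by rewrite L1normE.
pose g := nneseries_fun G.
have mg : measurable_fun setT g by exact: measurable_nneseries_fun.
have g0 s : (0 <= g s)%E by exact: nneseries_fun_ge0.
have gy := le_lt_trans (integral_nneseries_fun_le mG G0 Gc uC) (ltry C).
have ae_g := ae_nneseries_fun_fin mG G0 Gc uC.
pose S n s := series (fun k => L1fun (u k) s) n.
have mS n : measurable_fun setT (S n).
  rewrite /S /series /=; apply: measurable_sum => k; exact: measurable_L1fun.
(* The upper limit is measurable and equals the limit wherever the series converges. *)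
pose y s := fine (limn_esup (fun n => (S n s)%:E)).
have my : measurable_fun setT y.
  apply: measurableT_comp; first exact: fine_measurable.
  by apply: measurable_fun_limn_esup => n; apply/measurable_EFinP.
have ae_S : \forall s \ae mu, (fun n => S n s) @ \oo --> y s /\
    forall n, (`|S n s|%:E <= g s)%E.
  apply: filterS ae_g => s [gs Gs serG].
  have S_le n : `|S n s| <= fine (g s).
    by apply: le_trans (serG n); exact: ler_norm_sum.
  split; last by move=> n; rewrite /g -(fineK gs) lee_fin.
  have cS : cvgn (series (fun k => L1fun (u k) s)).
    apply: normed_cvg; apply: is_cvg_series_le_bound; first by move=> k;
      exact: normr_ge0.
    exact: serG.
  have cSE : (fun n => (S n s)%:E) @ \oo --> (limn (S^~ s))%:E.
    by apply: cvg_EFin => //; exact: nearW.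
  by rewrite /y (cvg_limn_einf_sup cSE).2.
have yL : y \in Lfun mu 1.
  apply: (ae_le_Lfun1 my mg g0 _ gy).
  apply: filterS2 ae_g ae_S => s [gs _ _] [Sy Sg].
  rewrite /g -(fineK gs) lee_fin.
  have ny : (fun n => `|S n s|) @ \oo --> `|y s| by exact: cvg_norm.
  by apply: (cvgr_to_le ny); apply: nearW => n; rewrite -lee_fin fineK.
exists (L1class yL); split; last first.
  by apply: filterS2 (L1classE yL) ae_S => s -> [].
have ig : mu.-integrable setT g.
  by apply/integrableP; split => //; under eq_integral do rewrite gee0_abs//.
have [||||_ + _] := @dominated_convergence _ _ _ mu _ measurableT
  (fun n s => (S n s)%:E) (fun s => (y s)%:E) g _ _ _ ig.
- by move=> n; exact/measurable_EFinP.
- exact/measurable_EFinP.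
- apply: filterS ae_S => s [Sy _] _.
  by apply: cvg_EFin => //; exact: nearW.
- by apply: filterS ae_S => s [_ Sg] n _; exact: Sg.
move=> /fine_cvg; apply: cvg_trans; apply: near_eq_cvg; apply: nearW => n /=.
congr fine; apply: ge0_ae_eq_integral => //.
- apply/measurable_EFinP; apply: measurableT_comp => //.
  exact: measurable_funB.
- apply: filterS3 (L1_subE (L1class yL) (series u n)) (L1classE yL)
    (L1_seriesE u) => s -> -> us _.
  by rewrite us distrC.
Qed.

End L1Norm.

Arguments L1norm {d T R mu}.

(** * The maximal inequality for a sigma-order basis *)

Section Basis.
Context d (T : measurableType d) (R : realType).
Context (mu : {measure set T -> \bar R}).
Local Notation L1 := (L1space mu).
Context (e : nat -> L1).
Implicit Types (x y : L1) (b c : nat -> R).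

(** Computed on fixed representatives, so that it is defined and linear in [b] at every point [s],
    not just a.e. *)
Definition psum b (m : nat) (s : T) : R :=
  series (fun n => b n * L1fun (e n) s) m.

(** Pointwise form of the order convergence of the expansion, by the characterization as dominated
    a.e. convergence. *)
Definition expands b x : Prop :=
  (\forall s \ae mu, (fun m => psum b m s) @ \oo --> L1fun x s) /\
  (\int[mu]_s maximal (psum b) s < +oo)%E.

Lemma measurable_psum b m : measurable_fun setT (psum b m).
Proof.
rewrite /psum /series /=; apply: measurable_sum => k.
by apply: measurable_funM => //; exact: measurable_L1fun.
Qed.

Lemma measurable_maximal_psum b : measurable_fun setT (maximal (psum b)).
Proof. by apply: measurable_maximal => m; exact: measurable_psum. Qed.

Lemma expandsP b x :
  sigma_order_cvg (series (fun n => b n *: e n)) x <-> expands b x.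
Proof.
have ae_psum : \forall s \ae mu, forall m,
    L1fun (series (fun n => b n *: e n) m) s = psum b m s.
  apply: filterS2 (L1_seriesE (fun n => b n *: e n))
    (ae_foralln (fun n => L1_scaleE (b n) (e n))) => s ser be m.
  by rewrite ser; apply: eq_bigr => k _; exact: be.
have maxE :
    (\int[mu]_s maximal (fun m => L1fun (series (fun n => b n *: e n) m)) s =
    \int[mu]_s maximal (psum b) s)%E.
  apply: ge0_ae_eq_integral => //.
  - by apply: measurable_maximal => m; exact: measurable_L1fun.
  - exact: measurable_maximal_psum.
  - by move=> s _; exact: maximal_ge0.
  - by move=> s _; exact: maximal_ge0.
  - apply: filterS ae_psum => s ps _; rewrite /maximal.
    by congr esups; apply/funext => m; rewrite ps.
split=> [/L1_cvg_dominated[sx sy]|[sx sy]].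
  split; last by rewrite -maxE.
  by apply: filterS2 ae_psum sx => s ps; under eq_fun do rewrite ps.
apply: L1_dominated_cvg; last by rewrite maxE.
by apply: filterS2 ae_psum sx => s ps;
  under [in X in _ -> X]eq_fun do rewrite ps.
Qed.

Lemma psumD b c m s : psum (b \+ c) m s = psum b m s + psum c m s.
Proof.
by rewrite /psum /series /= -big_split; apply: eq_bigr => k _; rewrite mulrDl.
Qed.

Lemma psumZ t b m s : psum (t \*o b) m s = t * psum b m s.
Proof.
by rewrite /psum /series /= big_distrr; apply: eq_bigr => k _; rewrite -mulrA.
Qed.

Lemma maximal_psumD b c s :
  (maximal (psum (b \+ c)%R) s <= maximal (psum b) s + maximal (psum c) s)%E.
Proof.
apply: maximal_le => m; rewrite psumD.
apply: (@le_trans _ _ (`|psum b m s|%:E + `|psum c m s|%:E)%E).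
  by rewrite -EFinD lee_fin ler_normD.
by apply: leeD; exact: maximal_ubound.
Qed.

Lemma maximal_psumZ t b s :
  (maximal (psum (t \*o b)) s <= `|t|%:E * maximal (psum b) s)%E.
Proof.
apply: maximal_le => m; rewrite psumZ normrM EFinM.
by apply: lee_wpmul2l; [rewrite lee_fin | exact: maximal_ubound].
Qed.

Let int_maxD b c : (\int[mu]_s maximal (psum (b \+ c)%R) s <=
  \int[mu]_s maximal (psum b) s + \int[mu]_s maximal (psum c) s)%E.
Proof.
rewrite -ge0_integralD//; last 4 first.
- by move=> s _; exact: maximal_ge0.
- exact: measurable_maximal_psum.
- by move=> s _; exact: maximal_ge0.
- exact: measurable_maximal_psum.
apply: ge0_le_integral => //.
- by move=> s _; exact: maximal_ge0.
- exact: measurable_maximal_psum.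
- by apply: emeasurable_funD; exact: measurable_maximal_psum.
- by move=> s _; exact: maximal_psumD.
Qed.

Let int_maxZ t b : (\int[mu]_s maximal (psum (t \*o b)) s <=
  `|t|%:E * \int[mu]_s maximal (psum b) s)%E.
Proof.
rewrite -ge0_integralZl//; last 2 first.
- exact: measurable_maximal_psum.
- by move=> s _; exact: maximal_ge0.
apply: ge0_le_integral => //.
- by move=> s _; exact: maximal_ge0.
- exact: measurable_maximal_psum.
- by apply: measurable_funeM; exact: measurable_maximal_psum.
- by move=> s _; exact: maximal_psumZ.
Qed.

Lemma expandsD b c x y : expands b x -> expands c y -> expands (b \+ c) (x + y).
Proof.
move=> [bx by_] [cy cy_]; split; last first.
  by apply: le_lt_trans (int_maxD b c) _; rewrite lte_add_pinfty.
apply: filterS3 (L1_addE x y) bx cy => s -> bx cy.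
by under eq_fun do rewrite psumD; exact: cvgD.
Qed.

Lemma expandsZ t b x : expands b x -> expands (t \*o b) (t *: x).
Proof.
move=> [bx by_]; split; last first.
  apply: le_lt_trans (int_maxZ t b) _; rewrite lte_mul_pinfty// lee_fin.
apply: filterS2 (L1_scaleE t x) bx => s -> bx.
by under eq_fun do rewrite psumZ; exact: cvgMr.
Qed.

Lemma psumS b m s : psum b m.+1 s = psum b m s + b m * L1fun (e m) s.
Proof. by rewrite /psum seriesSr. Qed.

(** * Coefficients and the maximal norm *)

Section Coefficients.
Context (a : L1 -> nat -> R).
Context (a_expands : forall x, expands (a x) x).
Context (a_unique : forall x b, expands b x -> a x = b).

(** The L_1 norm of [sup_m |P_m x|], with [P_m] the [m]-th partial sum operator; it plays the
    seminorm [q] of Zabreiko's lemma. *)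
Definition basis_norm x : R := fine (\int[mu]_s maximal (psum (a x)) s).

Lemma basis_normE x : ((basis_norm x)%:E = \int[mu]_s maximal (psum (a x)) s)%E.
Proof.
rewrite fineK// ge0_fin_numE; first by case: (a_expands x).
by apply: integral_ge0 => s _; exact: maximal_ge0.
Qed.

(** Uniqueness makes [a] linear, so the estimates for [maximal] transfer. *)
Lemma basis_norm_seminorm : seminorm (basis_norm : L1 -> R).
Proof.
have qZ t x : basis_norm (t *: x) <= `|t| * basis_norm x.
  rewrite -lee_fin EFinM !basis_normE (a_unique (expandsZ t (a_expands x))).
  exact: int_maxZ.
split=> [x y|t x].
  rewrite -lee_fin EFinD !basis_normE.
  by rewrite (a_unique (expandsD (a_expands x) (a_expands y))) int_maxD.
apply/eqP; rewrite eq_le qZ /=; have [->|t0] := eqVneq t 0.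
  by rewrite normr0 mul0r fine_ge0//; apply: integral_ge0 => s _;
    exact: maximal_ge0.
(* The reverse inequality is the one already proved, applied to [t^-1] and [t *: x]. *)
rewrite mulrC -ler_pdivlMr ?normr_gt0// mulrC -normfV.
by apply: le_trans (qZ _ _); rewrite scalerA mulVf// scale1r.
Qed.

Lemma ae_le_maximal b x : expands b x ->
  \forall s \ae mu, (`|L1fun x s|%:E <= maximal (psum b) s)%E.
Proof.
move=> [bx by_].
have := ae_lty_fin (measurable_maximal_psum b) (maximal_ge0 _) by_.
apply: filterS2 bx => s bxs fs.
rewrite -(fineK fs) lee_fin.
have nx : (fun m => `|psum b m s|) @ \oo --> `|L1fun x s| by exact: cvg_norm.
apply: (cvgr_to_le nx); apply: nearW => m.
by rewrite -lee_fin fineK// maximal_ubound.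
Qed.

Lemma L1norm_le_basis_norm x : L1norm x <= basis_norm x.
Proof.
apply: (L1norm_le (measurable_maximal_psum (a x)) (maximal_ge0 _)).
  exact: ae_le_maximal.
by rewrite basis_normE.
Qed.

(** The term [a x n *: e n] is the difference of two consecutive partial sums, each bounded by the
    maximal function. *)
Lemma coefficient_le x n : `|a x n| * L1norm (e n) <= 2 * basis_norm x.
Proof.
rewrite -(L1norm_seminorm mu).2.
apply: (L1norm_le (g := fun s => (2%:E * maximal (psum (a x)) s)%E)).
- by apply: measurable_funeM; exact: measurable_maximal_psum.
- by move=> s; rewrite mule_ge0// maximal_ge0.
- apply: filterS (L1_scaleE (a x n) (e n)) => s ->.
  have -> : a x n * L1fun (e n) s = psum (a x) n.+1 s - psum (a x) n s.
    by rewrite psumS addrC addKr.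
  apply: (@le_trans _ _ (`|psum (a x) n.+1 s|%:E + `|psum (a x) n s|%:E)%E).
    by rewrite -EFinD lee_fin ler_normB.
  have := maximal_ubound (psum (a x)) n.+1 s.
  have := maximal_ubound (psum (a x)) n s.
  case: (maximal _ s) => [r||]//=.
    by rewrite -EFinD -EFinM !lee_fin; lra.
  by move=> _ _; rewrite mulry gtr0_sg// mul1e leey.
- rewrite ge0_integralZl//; last 2 first.
  + exact: measurable_maximal_psum.
  + by move=> s _; exact: maximal_ge0.
  by rewrite EFinM basis_normE.
Qed.

(** If [e n] were 0, changing the [n]-th coefficient of the expansion of 0 would give a second
    expansion. *)
Lemma basis_L1norm_gt0 n : 0 < L1norm (e n).
Proof.
rewrite lt_neqAle seminorm_ge0 ?andbT; last exact: L1norm_seminorm.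
apply/eqP => /esym/L1norm_eq0 en0.
have : expands (a 0 \+ (fun k => (k == n)%:R)) 0.
  have [a0 a0y] := a_expands 0.
  have psE : \forall s \ae mu, forall m,
      psum (a 0 \+ (fun k => (k == n)%:R)) m s = psum (a 0) m s.
    apply: filterS (L1_zeroE mu) => s e0 m; apply: eq_bigr => k _.
    rewrite /=; have [->|_] := eqVneq k n; last by rewrite addr0.
    by rewrite en0 [L1fun 0 s]e0 !mulr0.
  split; first by apply: filterS2 psE a0 => s ps;
    under [in X in _ -> X]eq_fun do rewrite ps.
  apply: le_lt_trans a0y; apply: ae_ge0_le_integral => //.
  - by move=> s _; exact: maximal_ge0.
  - exact: measurable_maximal_psum.
  - by move=> s _; exact: maximal_ge0.
  - exact: measurable_maximal_psum.
  - apply: filterS psE => s ps _; apply: maximal_le => m.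
    by rewrite ps maximal_ubound.
move=> /a_unique/(congr1 (fun b => b n)) /= /eqP.
by rewrite eqxx -subr_eq0 opprD addNKr oppr_eq0 oner_eq0.
Qed.

(* The coefficients of [x] are the sums of those of the [u k]; Tannery's theorem
   exchanges that summation with the limit of the partial sums. *)
Lemma basis_norm_csubadd (u : nat -> L1) x C : series_to L1norm u x ->
  (forall n, series (basis_norm \o u) n <= C) -> basis_norm x <= C.
Proof.
move=> ux uC.
have [|y [uy ae_uy]] := @L1_complete _ _ _ _ u C.
  move=> n; apply: le_trans (uC n); apply: ler_sum => k _.
  exact: L1norm_le_basis_norm.
(* [x] is the given norm limit, [y] the one that is also an a.e. limit; they coincide, so a.e.
   convergence holds for [x]. *)
have xy : x = y.
  apply/eqP; rewrite -subr_eq0; apply/eqP/L1norm_eq0.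
  have ps := L1norm_seminorm mu.
  apply/eqP; rewrite eq_le seminorm_ge0 ?andbT//.
  have uxy : (fun n => L1norm (x - series u n) + L1norm (y - series u n))
      @ \oo --> (0 + 0 : R).
    exact: cvgD ux uy.
  rewrite addr0 in uxy; apply: (cvgr_to_ge uxy); apply: nearW => n.
  have := ps.1 (x - series u n) (series u n - y).
  by rewrite addrA subrK (seminorm_distC y _ ps).
subst y; clear uy.
pose G k s := maximal (psum (a (u k))) s.
have mG k : measurable_fun setT (G k) by exact: measurable_maximal_psum.
have G0 k s : (0 <= G k s)%E by exact: maximal_ge0.
have Gc k : (\int[mu]_s G k s = ((basis_norm \o u) k)%:E)%E
  by rewrite basis_normE.
pose g := nneseries_fun G.
have mg : measurable_fun setT g by exact: measurable_nneseries_fun.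
have g0 s : (0 <= g s)%E by exact: nneseries_fun_ge0.
have gC := integral_nneseries_fun_le mG G0 Gc uC.
have ae_g := ae_nneseries_fun_fin mG G0 Gc uC.
(* The candidate coefficients are absolutely convergent sums, since [|a (u k) n|] is at most
   [2 * basis_norm (u k) / L1norm (e n)]. *)
pose b n := limn (series (fun k => a (u k) n)).
have b_cvg n : series (fun k => a (u k) n) @ \oo --> b n.
  have en0 := basis_L1norm_gt0 n.
  apply: normed_cvg.
  apply: (@is_cvg_series_le_bound _ _ (2 * C / L1norm (e n))).
    by move=> k; exact: normr_ge0.
  move=> m; rewrite ler_pdivlMr// mulrC /series /= big_distrr /=.
  apply: le_trans (_ : 2 * series (basis_norm \o u) m <= _); last first.
    by rewrite ler_pM2l.
  rewrite /series /= [leRHS]big_distrr /=; apply: ler_sum => k _.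
  by rewrite mulrC; exact: coefficient_le.
have psum_cvg m s : series (fun k => psum (a (u k)) m s) @ \oo --> psum b m s.
  elim: m => [|m IH].
    rewrite /psum /series /= big_geq//;
      under eq_fun do under eq_bigr do rewrite big_geq//.
    by under eq_fun do rewrite big1//; exact: cvg_cst.
  rewrite psumS.
  have -> : series (fun k => psum (a (u k)) m.+1 s) = fun K =>
      series (fun k => psum (a (u k)) m s) K +
      series (fun k => a (u k) m) K * L1fun (e m) s.
    apply/funext => K; rewrite /series /= big_distrl -big_split /=.
    by apply: eq_bigr => k _; rewrite psumS.
  by apply: cvgD => //; apply: cvgMl.
(* At almost every [s], [G k s] dominates [psum (a (u k)) m s] uniformly in [m] and is summable in
   [k]: the domination that [tannery] requires. *)
have ae_b : \forall s \ae mu, (maximal (psum b) s <= g s)%E /\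
    (fun m => psum b m s) @ \oo --> L1fun x s.
  have ae_u : \forall s \ae mu, forall k,
      (fun m => psum (a (u k)) m s) @ \oo --> L1fun (u k) s.
    by apply: ae_foralln => k; case: (a_expands (u k)).
  apply: filterS3 ae_g ae_u ae_uy => s [gs Gs serG] us xs.
  have uG k m : `|psum (a (u k)) m s| <= fine (G k s).
    by rewrite -lee_fin fineK// maximal_ubound.
  split; last exact: (tannery uG serG us (psum_cvg^~ s) xs).
  apply: maximal_le => m; rewrite /g -(fineK gs) lee_fin.
  exact: (series_norm_le (uG^~ m) serG (psum_cvg m s)).
have int_b : (\int[mu]_s maximal (psum b) s <= C%:E)%E.
  apply: le_trans gC; apply: ae_ge0_le_integral => //.
  - by move=> s _; exact: maximal_ge0.
  - exact: measurable_maximal_psum.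
  - by apply: filterS ae_b => s [].
have bx : expands b x.
  split; first by apply: filterS ae_b => s [].
  exact: le_lt_trans int_b (ltry C).
by rewrite -lee_fin basis_normE (a_unique bx).
Qed.

(** The maximal inequality, from Zabreiko's lemma with [p] the L_1 norm. *)
Lemma basis_norm_bounded :
  exists2 M, 0 <= M & forall x, basis_norm x <= M * L1norm x.
Proof.
apply: zabreiko.
- exact: L1norm_seminorm.
- exact: basis_norm_seminorm.
- by move=> u C /L1_complete[x [ux _]]; exists x.
- exact: basis_norm_csubadd.
Qed.

End Coefficients.
End Basis.

Section BasisBounded.
Context d (T : measurableType d) (R : realType).
Context (mu : {measure set T -> \bar R}).
Local Notation L1 := (L1space mu).

(** The input of the dyadic argument: additive coefficients, each bounded in the L_1 norm, and the
    maximal inequality. *)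
Lemma sigma_order_basis_maximal_le (e : nat -> L1) : sigma_order_basis e ->
  exists (a : L1 -> nat -> R) (M : R) (c : nat -> R),
  [/\ forall x, expands e (a x) x,
      forall x y, a (x + y) = a x \+ a y,
      forall x n, `|a x n| <= c n * L1norm x &
      forall x, (\int[mu]_s maximal (psum e (a x)) s <= (M * L1norm x)%:E)%E].
Proof.
move=> e_basis.
have [a aP] := choice e_basis.
have a_expands x : expands e (a x) x by apply/expandsP; exact: (aP x).1.
have a_unique x b : expands e b x -> a x = b by move=> /expandsP;
  exact: (aP x).2.
have [M M0 aM] := basis_norm_bounded a_expands a_unique.
(* [c n] combines [coefficient_le] with [basis_norm x <= M * L1norm x]. *)
exists a, M, (fun n => 2 * M / L1norm (e n)); split=> // [x y|x n|x].
- by apply: a_unique; exact: expandsD.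
- rewrite mulrAC ler_pdivlMr; last exact: (basis_L1norm_gt0 a_expands a_unique).
  apply: le_trans (coefficient_le a_expands x n) _.
  by rewrite -mulrA ler_pM2l.
- by rewrite -(basis_normE a_expands) lee_fin.
Qed.

End BasisBounded.

(** * Dyadic intervals of [0, 1] *)

Section UnitInterval.
Context (R : realType).
Let mu : {measure set (measurableTypeR R) -> \bar R} :=
  mrestr (@lebesgue_measure R) (measurable_itv `[0, 1]).

(** Half-open, so that an interval is the disjoint union of its two halves at every point, endpoints
    included. *)
Definition dyadic_itv (k i : nat) : set R :=
  `[i%:R / 2 ^+ k, i.+1%:R / 2 ^+ k[%classic.

Lemma measurable_dyadic_itv k i :
  measurable (dyadic_itv k i : set (measurableTypeR R)).
Proof. exact: measurable_itv. Qed.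

(** Only an upper bound, because [mu] is restricted to [0, 1] and [i] may lie beyond [2 ^ k]. *)
Lemma measure_dyadic_itv_le k i : (mu (dyadic_itv k i) <= (2 ^- k)%:E)%E.
Proof.
apply: (@le_trans _ _ (lebesgue_measure (dyadic_itv k i))).
  rewrite /mu /= /mrestr; apply: le_measure; rewrite ?inE//=.
  - by apply: measurableI => //; exact: measurable_dyadic_itv.
  - exact: measurable_dyadic_itv.
rewrite lebesgue_measure_itv /= lte_fin; case: ifP => _;
  last by rewrite lee_fin invr_ge0 exprn_ge0.
by rewrite -EFinB lee_fin -mulrBl -natrB// subSnn mul1r.
Qed.

Lemma dyadic_itv_mem (k : nat) (s : R) : 0 <= s < 1 ->
  exists2 i, (i < 2 ^ k)%N & dyadic_itv k i s.
Proof.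
move=> /andP[s0 s1]; exists (Num.truncn (s * 2 ^+ k)).
  rewrite -(@ltr_nat R) natrX (@le_lt_trans _ _ (s * 2 ^+ k))//.
    by rewrite truncn_le mulr_ge0// exprn_ge0.
  by rewrite gtr_pMl// exprn_gt0.
rewrite /dyadic_itv /= in_itv /= ler_pdivrMr ?ltr_pdivlMr ?exprn_gt0//.
by rewrite truncn_le truncnS_gt mulr_ge0// exprn_ge0.
Qed.

Lemma indic_dyadic_itvS k i (s : R) :
  \1_(dyadic_itv k i) s =
  \1_(dyadic_itv k.+1 i.*2) s + \1_(dyadic_itv k.+1 i.*2.+1) s :> R.
Proof.
have k0 : 0 < 2 ^+ k :> R by rewrite exprn_gt0.
have E n : (n%:R / 2 ^+ k.+1 <= s) = (n%:R <= 2 * (s * 2 ^+ k)).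
  by rewrite ler_pdivrMr ?exprn_gt0// exprS mulrCA.
have E' n : (s < n%:R / 2 ^+ k.+1) = (2 * (s * 2 ^+ k) < n%:R).
  by rewrite ltr_pdivlMr ?exprn_gt0// exprS mulrCA.
rewrite !indicE !mem_setE !in_itv /= !E !E' ler_pdivrMr// ltr_pdivlMr//.
rewrite -doubleS -!muln2 -[(i * 2).+1]addn1 -[i.+1]addn1 !natrM !natrD natrM.
set t := s * 2 ^+ k; move: (i%:R) => r.
(* With [u = 2 * t], [p = r * 2] and [q = (r + 1) * 2], the parent is [r <= t < r + 1] and its
   halves are [p <= u < p + 1] and [p + 1 <= u < q]. *)
have [u tu] : {u | u = 2 * t} by exists (2 * t).
have [p rp] : {p | p = r * 2} by exists (r * 2).
have [q rq] : {q | q = (r + 1) * 2} by exists ((r + 1) * 2).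
rewrite -tu -rp -rq.
have [h1|h1] := leP r t; have [h2|h2] := ltP t (r + 1);
  have [h3|h3] := leP p u; have [h4|h4] := leP (p + 1) u;
  have [h5|h5] := ltP u q; rewrite /= ?addr0 ?add0r //; lra.
Qed.

Lemma indic_dyadic_Lfun k i : \1_(dyadic_itv k i) \in Lfun mu 1.
Proof.
apply/Lfun1_integrable/integrableP; split.
  by apply/measurable_EFinP;
    exact: measurable_indic (measurable_dyadic_itv k i).
under eq_integral do rewrite /= normr_nat.
rewrite integral_indic ?setIT//; last exact: measurable_dyadic_itv.
exact: le_lt_trans (measure_dyadic_itv_le k i) (ltry _).
Qed.

Definition dyadic_indicator k i : L1space mu := L1class (indic_dyadic_Lfun k i).

Lemma dyadic_indicatorS k i : dyadic_indicator k i =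
  dyadic_indicator k.+1 i.*2 + dyadic_indicator k.+1 i.*2.+1.
Proof.
apply: L1_ext; near=> s.
have -> : L1fun (dyadic_indicator k.+1 i.*2 + dyadic_indicator k.+1 i.*2.+1) s =
    L1fun (dyadic_indicator k.+1 i.*2) s +
    L1fun (dyadic_indicator k.+1 i.*2.+1) s.
  by near: s; exact: L1_addE.
rewrite (near (L1classE (indic_dyadic_Lfun k i)) s)//.
rewrite (near (L1classE (indic_dyadic_Lfun k.+1 i.*2)) s)//.
rewrite (near (L1classE (indic_dyadic_Lfun k.+1 i.*2.+1)) s)//.
exact: indic_dyadic_itvS.
Unshelve. all: by end_near. Qed.

Lemma L1norm_dyadic_indicator_le k i : L1norm (dyadic_indicator k i) <= 2 ^- k.
Proof.
pose g (s : measurableTypeR R) := (\1_(dyadic_itv k i) s : R)%:E.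
apply: (L1norm_le (g := g)); rewrite {}/g.
- by apply/measurable_EFinP;
  exact: measurable_indic (measurable_dyadic_itv k i).
- by move=> s; rewrite lee_fin.
- by apply: filterS (L1classE (indic_dyadic_Lfun k i)) => s ->;
  rewrite ger0_norm.
- rewrite integral_indic ?setIT//; last exact: measurable_dyadic_itv.
  exact: measure_dyadic_itv_le.
Qed.

(** [[0, 1[] has measure 1, so no null set contains it. The point 1 is left out because the
    level-[k] intervals with [i < 2 ^ k] do not cover it. *)
Lemma ae_unit_interval_witness (P : R -> Prop) :
  (\forall s \ae mu, P s) -> exists2 s, 0 <= s < 1 & P s.
Proof.
move=> [N [mN N0 PN]]; apply: contrapT => nP.
have : (mu `[0%R, 1%R[%classic <= mu N)%E.
  apply: le_measure; rewrite ?inE//=.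
  move=> s /=; rewrite in_itv /= => s01; apply: PN => Ps.
  by apply: nP; exists s.
rewrite N0 /mu /= /mrestr setIidl; last first.
  by move=> s /=; rewrite !in_itv /= => /andP[-> /ltW].
by rewrite lebesgue_measure_itv /= lte_fin ltr01 oppr0 adde0 lee_fin ler10.
Qed.

Lemma L1_unit_interval_no_basis (e : nat -> L1space mu) : ~ sigma_order_basis e.
Proof.
move=> /sigma_order_basis_maximal_le[a [M [c [a_expands aD ac aM]]]].
pose X := dyadic_indicator.
(* [H k s] is the sum over the intervals of level [k] of [sup_m |P_m 1_I (s)|]. *)
pose H k s := (\sum_(0 <= i < 2 ^ k) maximal (psum e (a (X k i))) s)%E.
have mH k : measurable_fun setT (H k).
  by apply: emeasurable_sum => i; exact: measurable_maximal_psum.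
have H0 k s : (0 <= H k s)%E by apply: sume_ge0 => i _; exact: maximal_ge0.
have nuD m k i s : psum e (a (X k i)) m s =
    psum e (a (X k.+1 i.*2)) m s + psum e (a (X k.+1 i.*2.+1)) m s.
  by rewrite -psumD -aD -dyadic_indicatorS.
have HS s : nondecreasing_seq (H ^~ s).
  apply/nondecreasing_seqP => k; rewrite /H expnS mul2n.
  rewrite big_nat_double.
  apply: lee_sum => i _; rewrite {1}/X dyadic_indicatorS aD.
  exact: maximal_psumD.
(* Each of the [2 ^ k] indicators has norm at most [2 ^- k], so the maximal inequality sums to a
   bound independent of [k]; [|M|] is used since the sign of [M] is not recorded. *)
have HM k : (\int[mu]_s H k s <= `|M|%:E)%E.
  rewrite ge0_integral_sum//; last 2 first.
  - by move=> i; exact: measurable_maximal_psum.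
  - by move=> i s _; exact: maximal_ge0.
  apply: (@le_trans _ _ (\sum_(0 <= i < 2 ^ k) (`|M| * 2 ^- k)%:E)%E).
    apply: lee_sum => i _; apply: le_trans (aM _) _; rewrite lee_fin.
    apply: le_trans (ler_wpM2r _ (ler_norm M)) _.
      by apply: seminorm_ge0; exact: L1norm_seminorm.
    by rewrite ler_wpM2l// L1norm_dyadic_indicator_le.
  rewrite sumEFin lee_fin sumr_const_nat subn0 -[X in X <= _]mulr_natr natrX.
  by rewrite -mulrA mulVf ?mulr1// expf_neq0.
(* By monotone convergence the limit has finite integral, so at almost every [s] it is one finite
   bound for all levels. *)
pose Hlim s := limn (H ^~ s).
have H_le k s : (H k s <= Hlim s)%E.
  have cH := @ereal_nondecreasing_is_cvgn _ _ (HS s).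
  apply: lime_ge => //; exists k => // n /= kn; exact: HS.
have mHlim : measurable_fun setT Hlim.
  apply: (@emeasurable_fun_cvg _ _ _ _ H Hlim mH) => s _.
  exact: ereal_nondecreasing_is_cvgn.
have intHlim : (\int[mu]_s Hlim s <= `|M|%:E)%E.
  rewrite monotone_convergence//; apply: lime_le; last exact: nearW.
  apply: ereal_nondecreasing_is_cvgn => k k' kk'; apply: ge0_le_integral => //.
  by move=> s _; exact: HS.
have ae_Hlim : \forall s \ae mu, Hlim s \is a fin_num.
  apply: ae_lty_fin => //; last exact: le_lt_trans intHlim (ltry _).
  by move=> s; exact: le_trans (H_le 0%N s).
have ae_X : \forall s \ae mu, forall k i,
    (fun m => psum e (a (X k i)) m s) @ \oo --> (\1_(dyadic_itv k i) s : R).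
  apply: ae_foralln => k; apply: ae_foralln => i.
  apply: filterS2 (L1classE (indic_dyadic_Lfun k i)) (a_expands (X k i)).1 => s.
  by rewrite /X /dyadic_indicator => ->.
have ae_both : \forall s \ae mu, Hlim s \is a fin_num /\ forall k i,
    (fun m => psum e (a (X k i)) m s) @ \oo --> (\1_(dyadic_itv k i) s : R).
  by apply: filterS2 ae_Hlim ae_X => s.
have [s s01 [Hs Xs]] := ae_unit_interval_witness ae_both.
pose nu m k i := psum e (a (X k i)) m s.
(* The density bound: each [|a (X k i) n|] is at most [|c n| * 2 ^- k]. *)
pose C m := \sum_(0 <= n < m) `|c n| * `|L1fun (e n) s|.
apply: (@dyadic_dirac_not_approx R nu C (fine (Hlim s))) => [m k i|m k i|m k|k].
- exact: nuD.
- rewrite /nu /psum /series /= /C big_distrl /=.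
  apply: le_trans (ler_norm_sum _ _ _) _; apply: ler_sum => n _.
  rewrite normrM mulrAC ler_wpM2r//.
  apply: le_trans (ac _ _) _; apply: le_trans (ler_wpM2r _ (ler_norm _)) _.
    by apply: seminorm_ge0; exact: L1norm_seminorm.
  by rewrite ler_wpM2l// L1norm_dyadic_indicator_le.
- rewrite -lee_fin fineK//; apply: le_trans (H_le k s).
  rewrite -sumEFin; apply: lee_sum => i _.
  apply: (big_ind (fun r => (r%:E <= maximal (psum e (a (X k i))) s)%E)).
  + exact: maximal_ge0.
  + by move=> r r' hr hr'; rewrite EFin_max ge_max hr.
  + by move=> j _; exact: maximal_ubound.
- have [i ik si] := dyadic_itv_mem k s01; exists i => //.
  by have := Xs k i; rewrite indicE mem_set.
Qed.

End UnitInterval.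

Theorem corollary1p12 (R : realType) :
  ~ exists e : nat -> L1_01 R, sigma_order_basis e.
Proof. by move=> [e]; exact: L1_unit_interval_no_basis. Qed.
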